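(* Let $F_\infty$ be the free group on the countably infinite set of generators $x_0,x_1,x_2,\ldots$. Let $\theta:\{x_0,x_1,x_2,\ldots\}\to F_\infty$ be a surjective map such that, for each $i\ge 0$, $\theta(x_i)$ is a word involving only the variables $x_0,x_1,\ldots,x_{i-1}$ (so $\theta(x_0)=1$), and let $\varphi:F_\infty\to F_\infty$ be the automorphism determined by $\varphi(x_i)=\theta(x_i)x_i$ for all $i\geq 0$. Then $R(\varphi)=1$. Hence $F_\infty$ does not have property $R_\infty$, and neither does any of the groups $N_{\infty,c}$, $M_{\infty,c}$ or $S_{\infty,k}$ (for positive integers $c$, $k$).
   Context: For a group $G$ and an endomorphism $\varphi$ of $G$, elements $x,y\in G$ are Reidemeister equivalent if there is $z\in G$ with $x=zy\varphi(z)^{-1}$. The Reidemeister number $R(\varphi)\in\{1,2,3,\ldots\}\cup\{\infty\}$ is the number of equivalence classes. A group $G$ has property $R_\infty$ if $R(\varphi)=\infty$ for every automorphism $\varphi$ of $G$. For a group $G$, the lower central series is $\gamma_1(G)=G$, $\gamma_{i+1}(G)=[\gamma_i(G),G]$, and the derived series is $G^{(0)}=G$, $G^{(i+1)}=[G^{(i)},G^{(i)}]$. Set $N_{\infty,c}=F_\infty/\gamma_{c+1}(F_\infty)$, $M_{\infty,c}=F_\infty/\big(\gamma_{c+1}(F_\infty)F_\infty^{(2)}\big)$ and $S_{\infty,k}=F_\infty/F_\infty^{(k)}$. Surjective maps $\theta$ with the stated property exist, and for such $\theta$ the homomorphism $\varphi$ is an automorphism of $F_\infty$. *)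

(* Defs.v *)
From HB Require Import structures.
From mathcomp Require Import all_boot finmap.
From mathcomp Require Import boolp classical_sets functions cardinality.
From mathcomp Require Import constructive_ereal.

Set Implicit Arguments.
Unset Strict Implicit.
Unset Printing Implicit Defensive.

Local Open Scope classical_set_scope.
Local Open Scope group_scope.

Section Reidemeister.
Variables (G : groupType) (phi : {multiplicative G -> G}).

Definition reidemeister_equiv (x y : G) : Prop :=
  exists z : G, x = z * y * (phi z)^-1.

Definition reidemeister_classes : set (set G) :=
  [set [set x | reidemeister_equiv x y] | y in [set: G]].

Definition reidemeister_number : \bar nat :=
  if `[< finite_set reidemeister_classes >]
  then (#|` fset_set reidemeister_classes|)%fset%:E else +oo%E.

End Reidemeister.

Definition R_infinity (G : groupType) : Prop :=
  forall phi : {multiplicative G -> G},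
    bijective phi -> reidemeister_number phi = +oo%E.

(* The free group on X: reduced words in the letters (x, b), where (x, true)
   stands for x and (x, false) for x^-1. *)
Section FreeGroup.
Variable X : choiceType.

Definition letter_inv (a : X * bool) : X * bool := (a.1, ~~ a.2).

Definition reduced (w : seq (X * bool)) : bool :=
  sorted (fun a b => b != letter_inv a) w.

Record free_group := FreeGroup {
  free_word :> seq (X * bool);
  free_word_reduced : reduced free_word }.

HB.instance Definition _ := [isSub for free_word].
HB.instance Definition _ := [Choice of free_group by <:].

Definition push (a : X * bool) (w : seq (X * bool)) : seq (X * bool) :=
  if w is b :: w' then if b == letter_inv a then w' else a :: w else [:: a].

Definition push_word (u w : seq (X * bool)) : seq (X * bool) := foldr push w u.

Definition word_inv (w : seq (X * bool)) : seq (X * bool) :=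
  rev (map letter_inv w).

Lemma letter_invK : involutive letter_inv.
Proof. by case=> x b; rewrite /letter_inv /= negbK. Qed.

Lemma push_reduced a w : reduced w -> reduced (push a w).
Proof.
case: w => [|b w] //= ; case: eqP => [_|/eqP ne] /=; last by rewrite ne.
by case: w => [|c w] //= /andP[].
Qed.

Lemma push_word_reduced u w : reduced w -> reduced (push_word u w).
Proof. by move=> rw; elim: u => //= a u; apply: push_reduced. Qed.

Lemma pushK a w : reduced w -> push a (push (letter_inv a) w) = w.
Proof.
case: w => [|b w] /=; first by rewrite eqxx.
rewrite letter_invK; case: eqP => [->|ne] rw /=; last by rewrite eqxx.
by case: w rw => [|c w] //= /andP[/negbTE ->].
Qed.

Lemma push_wordA u v w : reduced w ->
  push_word (push_word u v) w = push_word u (push_word v w).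
Proof.
move=> rw; elim: u => //= a u <-; move: (push_word u v) => {u v} [|b u] //=.
case: eqP => [->|//]; rewrite pushK //; exact: push_word_reduced.
Qed.

Lemma push_word_nil u : reduced u -> push_word u [::] = u.
Proof.
elim: u => //= a u IH rau; rewrite IH; last exact: path_sorted rau.
by case: u rau {IH} => //= b u /andP[/negbTE ->].
Qed.

Lemma word_inv_reduced w : reduced w -> reduced (word_inv w).
Proof.
rewrite /reduced /word_inv rev_sorted sorted_map; apply: sub_sorted => a b /=.
by apply: contra => /eqP ->; rewrite !letter_invK.
Qed.

Lemma push_word_invK u w : reduced w -> push_word (word_inv u) (push_word u w) = w.
Proof.
move=> rw; elim: u => //= a u IH.
rewrite /word_inv /= rev_cons /push_word foldr_rcons.
by rewrite -{2}[a]letter_invK pushK //; apply: push_word_reduced.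
Qed.

Definition free_one : free_group := @FreeGroup [::] isT.

Definition free_mul (u v : free_group) : free_group :=
  FreeGroup (push_word_reduced u (free_word_reduced v)).

Definition free_inv (u : free_group) : free_group :=
  FreeGroup (word_inv_reduced (free_word_reduced u)).

Lemma free_mulA : associative free_mul.
Proof.
by move=> u v w; apply: val_inj; rewrite /= push_wordA ?free_word_reduced.
Qed.

Lemma free_mul1 : left_id free_one free_mul.
Proof. by move=> u; apply: val_inj. Qed.

Lemma free_mulr1 : right_id free_one free_mul.
Proof. by move=> u; apply: val_inj; rewrite /= push_word_nil ?free_word_reduced. Qed.

Lemma free_mulV : left_inverse free_one free_inv free_mul.
Proof.
move=> u; apply: val_inj => /=.
by rewrite -{2}(push_word_nil (free_word_reduced u)) push_word_invK.
Qed.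

Lemma free_mulVr : right_inverse free_one free_inv free_mul.
Proof.
move=> u; rewrite -{1}(free_mul1 u) -(free_mulV (free_inv u)) -!free_mulA.
by rewrite (free_mulA _ u) free_mulV free_mul1.
Qed.

HB.instance Definition _ := isGroup.Build free_group
  free_mulA free_mul1 free_mulr1 free_mulV free_mulVr.

Definition free_gen (x : X) : free_group := @FreeGroup [:: (x, true)] isT.

Section UniversalProperty.
Variables (G : groupType) (f : X -> G).

Definition letter_eval (a : X * bool) : G := if a.2 then f a.1 else (f a.1)^-1.

Definition word_eval (w : seq (X * bool)) : G :=
  foldr (fun a g => letter_eval a * g) 1 w.

Definition free_lift (w : free_group) : G := word_eval w.

Lemma free_liftM : {morph free_lift : u v / u * v}.
Proof.
move=> [u ru] [v rv]; rewrite /free_lift /=.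
elim: u {ru} => [|a u IH] /=; first by rewrite mul1g.
rewrite -mulgA -IH; case: (push_word u v) => [|b w] //=.
case: eqP => // ->; rewrite mulgA /letter_eval /=.
by case: a.2; rewrite /= ?mulgV ?mulVg mul1g.
Qed.

HB.instance Definition _ :=
  isMultiplicative.Build free_group G free_lift free_liftM.

Lemma free_lift_gen x : free_lift (free_gen x) = f x.
Proof. exact: mulg1. Qed.

Lemma free_lift_unique (h : {multiplicative free_group -> G}) :
  (forall x, h (free_gen x) = f x) -> h =1 free_lift.
Proof.
have h1 : h 1 = 1 by apply: (mulgI (h 1)); rewrite -gmulfM !mulg1.
move=> hf [u]; elim: u => [|[x b] u IH] ru.
  by rewrite -[LHS]/(h _) (_ : FreeGroup ru = 1) //; apply: val_inj.
have ru' : reduced u := path_sorted ru.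
have -> : FreeGroup ru =
    (if b then free_gen x else (free_gen x)^-1) * FreeGroup ru'.
  apply: val_inj; case: b ru => /=; case: u ru' {IH} => //= c u _;
    by case/andP=> /negbTE ->.
rewrite gmulfM IH free_liftM; congr (_ * _).
have hV : h (free_gen x)^-1 = (f x)^-1.
  by apply: (mulgI (f x)); rewrite mulgV -hf -gmulfM mulgV h1.
by case: b {ru}; rewrite ?hV ?hf //; symmetry; exact: mulg1.
Qed.

End UniversalProperty.
End FreeGroup.

Section NormalSubgroups.
Variable G : groupType.
Implicit Types A B : set G.

Definition subgroup A : Prop :=
  [/\ A 1, forall x y, A x -> A y -> A (x * y) & forall x, A x -> A x^-1].

Definition normal_subgroup A : Prop :=
  subgroup A /\ forall x g, A x -> A (x ^ g).

Record nsubgroup := NSubgroup {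
  nsubgroup_set :> set G;
  nsubgroupP : normal_subgroup nsubgroup_set }.
Implicit Types H K : nsubgroup.

Lemma whole_normal : normal_subgroup [set: G].
Proof. by []. Qed.
Definition whole : nsubgroup := NSubgroup whole_normal.

Definition commutator A B : set G :=
  smallest subgroup [set [~ a, b] | a in A & b in B].

Lemma commutator_normal H K : normal_subgroup (commutator H K).
Proof.
split; first split.
- by move=> S [[]].
- move=> x y Hx Hy S SS; have [[_ SM _] _] := SS.
  by apply: SM; [apply: Hx | apply: Hy].
- by move=> x Hx S SS; have [[_ _ SV] _] := SS; apply: SV; apply: Hx.
move=> x g Hx S [[S1 SM SV] Sc].
apply: (Hx [set y | S (y ^ g)]); split; first split => /=.
- by rewrite conj1g.
- by move=> y z Sy Sz; rewrite conjMg; apply: SM.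
- by move=> y Sy; rewrite conjVg; apply: SV.
move=> _ [a Ha [b Kb <-]] /=; apply: Sc; rewrite conjRg.
by exists (a ^ g); [apply: (nsubgroupP H).2 | exists (b ^ g) => //;
  apply: (nsubgroupP K).2].
Qed.
Definition ncommutator H K : nsubgroup := NSubgroup (commutator_normal H K).

Lemma product_normal H K : normal_subgroup [set a * b | a in H & b in K].
Proof.
have [[H1 HM HV] HJ] := nsubgroupP H; have [[K1 KM KV] KJ] := nsubgroupP K.
split; first split.
- by exists 1 => //; exists 1 => //; rewrite mulg1.
- move=> _ _ [a Ha [b Kb <-]] [c Hc [d Kd <-]].
  exists (a * c); first exact: HM.
  exists (b ^ c * d); first by apply: KM => //; apply: KJ.
  by rewrite conjgE !mulgA mulgK.
- move=> _ [a Ha [b Kb <-]].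
  exists a^-1; first exact: HV.
  exists (b^-1 ^ a^-1); first by apply/KJ/KV.
  by rewrite conjgE invgK invgM !mulgA mulVg mul1g.
move=> _ g [a Ha [b Kb <-]]; exists (a ^ g); first exact: HJ.
by exists (b ^ g); [exact: KJ | rewrite conjMg].
Qed.
Definition nproduct H K : nsubgroup := NSubgroup (product_normal H K).

(* [lower_central i] is gamma_i for i > 0, with the filler gamma_0 := G. *)
Definition lower_central (i : nat) : nsubgroup :=
  iter i.-1 (fun H => ncommutator H whole) whole.

Definition derived (i : nat) : nsubgroup :=
  iter i (fun H => ncommutator H H) whole.

End NormalSubgroups.

Section Quotient.
Variables (G : groupType) (H : nsubgroup G).

Definition coset_rel (x y : G) : bool := `[< nsubgroup_set H (x^-1 * y) >].

Lemma coset_rel_refl : reflexive coset_rel.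
Proof. by move=> x; apply/asboolP; rewrite mulVg; have [[]] := nsubgroupP H. Qed.

Lemma coset_rel_sym : symmetric coset_rel.
Proof.
have [[_ _ HV] _] := nsubgroupP H.
by move=> x y; apply/asboolP/asboolP => /HV; rewrite invgM invgK.
Qed.

Lemma coset_rel_trans : transitive coset_rel.
Proof.
have [[_ HM _] _] := nsubgroupP H.
move=> y x z /asboolP Hxy /asboolP Hyz; apply/asboolP.
by have := HM _ _ Hxy Hyz; rewrite mulgA mulgK.
Qed.

Canonical coset_equiv :=
  EquivRel coset_rel coset_rel_refl coset_rel_sym coset_rel_trans.

Local Open Scope quotient_scope.

Definition quotient_group : Type := {eq_quot coset_rel}.
HB.instance Definition _ := Choice.on quotient_group.
HB.instance Definition _ := EqQuotient.on quotient_group.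

Definition quotient_mul (a b : quotient_group) : quotient_group :=
  \pi_quotient_group (repr a * repr b).

Definition quotient_inv (a : quotient_group) : quotient_group :=
  \pi_quotient_group (repr a)^-1.

Lemma quotient_eqP (x y : G) :
  \pi_quotient_group x = \pi_quotient_group y <-> nsubgroup_set H (x^-1 * y).
Proof.
split=> [/eqP|Hxy]; last by apply/eqP; rewrite eqmodE; apply/asboolP.
by rewrite eqmodE => /asboolP.
Qed.

Lemma repr_pi (x : G) : nsubgroup_set H (x^-1 * repr (\pi_quotient_group x)).
Proof. by apply/quotient_eqP; rewrite reprK. Qed.

Lemma pi_mul : {morph \pi_quotient_group : x y / x * y >-> quotient_mul x y}.
Proof.
have [[_ HM _] HJ] := nsubgroupP H.
move=> x y; apply/quotient_eqP.
move: (repr_pi x) (repr_pi y).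
set x' := repr _; set y' := repr _ => Hx Hy.
have -> : (x * y)^-1 * (x' * y') = (x^-1 * x') ^ y * (y^-1 * y').
  by rewrite conjgE invgM !mulgA mulgK.
exact: HM _ _ (HJ _ _ Hx) Hy.
Qed.

Lemma pi_inv : {morph \pi_quotient_group : x / x^-1 >-> quotient_inv x}.
Proof.
have [[_ _ HV] HJ] := nsubgroupP H.
move=> x; apply/quotient_eqP; move: (repr_pi x); set x' := repr _ => Hx.
have -> : x^-1^-1 * x'^-1 = (x^-1 * x')^-1 ^ x^-1.
  by rewrite conjgE invgM !invgK !mulgA mulgK.
exact: HJ _ _ (HV _ Hx).
Qed.

Lemma quotient_mulA : associative quotient_mul.
Proof.
elim/quotW=> x; elim/quotW=> y; elim/quotW=> z.
by rewrite -(pi_mul y) -(pi_mul x y) -!pi_mul mulgA.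
Qed.

Lemma quotient_mul1 : left_id (\pi_quotient_group 1) quotient_mul.
Proof. by elim/quotW=> x; rewrite -pi_mul mul1g. Qed.

Lemma quotient_mulr1 : right_id (\pi_quotient_group 1) quotient_mul.
Proof. by elim/quotW=> x; rewrite -pi_mul mulg1. Qed.

Lemma quotient_mulV :
  left_inverse (\pi_quotient_group 1) quotient_inv quotient_mul.
Proof. by elim/quotW=> x; rewrite -pi_inv -pi_mul mulVg. Qed.

Lemma quotient_mulVr :
  right_inverse (\pi_quotient_group 1) quotient_inv quotient_mul.
Proof. by elim/quotW=> x; rewrite -pi_inv -pi_mul mulgV. Qed.

HB.instance Definition _ := isGroup.Build quotient_group
  quotient_mulA quotient_mul1 quotient_mulr1 quotient_mulV quotient_mulVr.

End Quotient.

Definition F_infty : groupType := free_group nat.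

Definition x_ (i : nat) : F_infty := free_gen i.

Definition involves_only_below (i : nat) (w : free_group nat) : bool :=
  all (fun a : nat * bool => a.1 < i) w.

Definition N_infty (c : nat) : groupType :=
  quotient_group (lower_central F_infty c.+1).

Definition M_infty (c : nat) : groupType :=
  quotient_group (nproduct (lower_central F_infty c.+1) (derived F_infty 2)).

Definition S_infty (k : nat) : groupType :=
  quotient_group (derived F_infty k).

(* Main.v *)
From HB Require Import structures.
Require Import Defs.
From mathcomp Require Import all_boot finmap.
From mathcomp Require Import boolp classical_sets cardinality.
From mathcomp Require Import constructive_ereal.

(** Since [phi (x_ i) = theta i * x_ i], the element [z := x_ i] gives
    [z * (phi z)^-1 = (theta i)^-1].  As [theta] is surjective, every element
    of the free group has the form [(theta i)^-1], so every element is
    Reidemeister equivalent to 1 and there is one class only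
    ([triangular_twisted_trivial], [reidemeister_number_one]).

    That [phi] is an automorphism is a triangularity argument
    ([triangular_bijective]).  Because [theta i] involves only generators of
    smaller index, the equations [psi (x_ i) = (psi (theta i))^-1 * x_ i] can be
    solved recursively for the values of a morphism [psi], and [psi] is then a
    two-sided inverse of [phi], as one checks on generators.

    For the quotients, an automorphism [phi] of [G] with all elements equivalent
    to 1 descends to an automorphism of [G / H] with the same property as soon
    as [H] is stable under [phi] and under its inverse
    ([quotient_not_R_infinity]).  The terms of the lower central and derived
    series, and products of them, are stable under all endomorphisms
    ([lower_central_fully_invariant], [derived_fully_invariant],
    [nproduct_fully_invariant]).

    Finally a map [theta] as required exists: the free group is countable, and
    an enumeration which repeats every element infinitely often reaches each
    word [g] at an index exceeding all the letters of [g]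
    ([triangular_surjection_exists]). *)

Set Implicit Arguments.
Unset Strict Implicit.
Unset Printing Implicit Defensive.

Local Open Scope group_scope.
Local Open Scope quotient_scope.

(** * Morphisms of groups *)

Section Morphisms.
Variables (G G' : groupType) (f : {multiplicative G -> G'}).

Lemma multiplicative1 : f 1 = 1.
Proof. by apply: (mulgI (f 1)); rewrite -gmulfM !mulg1. Qed.

Lemma multiplicativeV x : f x^-1 = (f x)^-1.
Proof. by apply: (mulgI (f x)); rewrite mulgV -gmulfM mulgV multiplicative1. Qed.

Lemma multiplicativeR x y : f [~ x, y] = [~ f x, f y].
Proof. by rewrite /commg /conjg !gmulfM !multiplicativeV. Qed.

End Morphisms.

(** * Reidemeister classes *)

(** If [x = z * (phi z)^-1] and [y = t * (phi t)^-1], then [z * t^-1] carries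
    [y] to [x]: all elements are equivalent to each other, and the only class is
    the whole group. *)
Lemma reidemeister_number_one (G : groupType) (phi : {multiplicative G -> G}) :
  (forall x, reidemeister_equiv phi x 1) -> reidemeister_number phi = 1%N%:E%E.
Proof.
move=> triv.
have equivT x y : reidemeister_equiv phi x y.
  have [z xz] := triv x; have [t yt] := triv y.
  exists (z * t^-1); rewrite xz yt gmulfM multiplicativeV invgM invgK !mulg1.
  by rewrite !mulgA !mulgVK.
have classT y : [set x | reidemeister_equiv phi x y]%classic = [set: G]%classic.
  by apply/seteqP; split=> x _ //=; apply: equivT.
have classesE : reidemeister_classes phi = [set [set: G]%classic]%classic.
  apply/seteqP; split=> [_ [y _ <-] /=|_ ->]; first exact: classT.
  by exists 1.
rewrite /reidemeister_number classesE asboolT; last exact: finite_set1.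
by rewrite fset_set1 cardfs1.
Qed.

Lemma trivial_not_R_infinity (G : groupType) (phi : {multiplicative G -> G}) :
  bijective phi -> (forall x, reidemeister_equiv phi x 1) -> ~ R_infinity G.
Proof.
by move=> phi_bij /reidemeister_number_one R1 /(_ phi phi_bij); rewrite R1.
Qed.

(** * Quotients by fully invariant subgroups *)

Definition fully_invariant (G : groupType) (H : nsubgroup G) : Prop :=
  forall (f : {multiplicative G -> G}) x,
    nsubgroup_set H x -> nsubgroup_set H (f x).

(** The preimage of [[H, K]] under [f] is a subgroup containing all the
    commutators that generate [[H, K]]. *)
Lemma ncommutator_fully_invariant (G : groupType) (H K : nsubgroup G) :
  fully_invariant H -> fully_invariant K -> fully_invariant (ncommutator H K).
Proof.
move=> Hf Kf f x HKx S [[S1 SM SV] Sc].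
apply: (HKx [set y | S (f y)]%classic); split; first split => /=.
- by rewrite multiplicative1.
- by move=> y z Sy Sz; rewrite gmulfM; apply: SM.
- by move=> y Sy; rewrite multiplicativeV; apply: SV.
move=> _ [a Ha [b Kb <-]] /=; apply: Sc; rewrite multiplicativeR.
by exists (f a); [apply: Hf | exists (f b) => //; apply: Kf].
Qed.

Lemma nproduct_fully_invariant (G : groupType) (H K : nsubgroup G) :
  fully_invariant H -> fully_invariant K -> fully_invariant (nproduct H K).
Proof.
move=> Hf Kf f _ [a Ha [b Kb <-]]; exists (f a); first exact: Hf.
by exists (f b); [exact: Kf | rewrite gmulfM].
Qed.

Lemma lower_central_fully_invariant (G : groupType) i :
  fully_invariant (lower_central G i).
Proof.
rewrite /lower_central; elim: i.-1 => [|n IH] //=.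
exact: ncommutator_fully_invariant.
Qed.

Lemma derived_fully_invariant (G : groupType) i : fully_invariant (derived G i).
Proof.
by elim: i => [|n IH] //=; apply: ncommutator_fully_invariant.
Qed.

Section QuotientMorphism.
Variables (G : groupType) (H : nsubgroup G).
Local Notation Q := (quotient_group H).
Hypothesis invH : fully_invariant H.

(** Cosets are handled through representatives; the choice is immaterial because
    [f] maps [H] into [H]. *)
Lemma quotient_morphism (f : {multiplicative G -> G}) :
  exists fQ : {multiplicative Q -> Q}, forall x, fQ (\pi_Q x) = \pi_Q (f x).
Proof.
pose g (a : Q) : Q := \pi_Q (f (repr a)).
have gpi x : g (\pi_Q x) = \pi_Q (f x).
  apply/esym/quotient_eqP; rewrite -multiplicativeV -gmulfM.
  exact/invH/repr_pi.
have gM : {morph g : a b / a * b}.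
  elim/quotW=> x; elim/quotW=> y.
  rewrite -[(\pi_Q x : Q) * _](pi_mul H x y) !gpi gmulfM.
  exact: (pi_mul H (f x) (f y)).
pose gm := isMultiplicative.Build Q Q g gM.
by exists (HB.pack g gm : {multiplicative Q -> Q}).
Qed.

(** Bijectivity passes to the quotient because the inverse of [phi] is an
    endomorphism too, so that it also descends. *)
Lemma quotient_not_R_infinity (phi : {multiplicative G -> G}) :
  bijective phi -> (forall x, reidemeister_equiv phi x 1) -> ~ R_infinity Q.
Proof.
move=> [psi phiK psiK] triv.
pose psim := isMultiplicative.Build G G psi (can2_gmulfM phiK psiK).
pose psi' : {multiplicative G -> G} := HB.pack psi psim.
have [phiQ phiQE] := quotient_morphism phi.
have [psiQ psiQE] := quotient_morphism psi'.
apply: (@trivial_not_R_infinity _ phiQ).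
  exists psiQ; elim/quotW=> x.
    by rewrite phiQE psiQE /= phiK.
  by rewrite psiQE phiQE /= psiK.
elim/quotW=> x; have [z xz] := triv x; exists (\pi_Q z).
by rewrite phiQE xz (pi_mul H) (pi_mul H) (pi_inv H).
Qed.

End QuotientMorphism.

(** * Triangular automorphisms of the free group *)

Lemma eq_morphism_below (G : groupType) (f g : {multiplicative F_infty -> G})
    n (w : F_infty) :
  involves_only_below n w -> (forall j, (j < n)%N -> f (x_ j) = g (x_ j)) ->
  f w = g w.
Proof.
move=> wn fg.
rewrite (@free_lift_unique _ _ (fun i => f (x_ i)) f) //.
rewrite (@free_lift_unique _ _ (fun i => g (x_ i)) g) //.
rewrite /free_lift; move: wn; rewrite /involves_only_below; elim: (free_word w) => //= a u IH /andP[an un].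
by rewrite IH // /letter_eval fg.
Qed.

Lemma morphism_id (f : {multiplicative F_infty -> F_infty}) :
  (forall i, f (x_ i) = x_ i) -> f =1 id.
Proof.
move=> fx w; rewrite (free_lift_unique fx).
by rewrite -(@free_lift_unique _ _ x_ idfun).
Qed.

Section Triangular.
Variable theta : nat -> F_infty.
Hypothesis theta_below : forall i, involves_only_below i (theta i).

(** The [n]-th approximation is correct on the generators of index [< n], which
    are all that the value at [x_ n] depends on. *)
Lemma triangular_recursion : exists f : nat -> F_infty,
  forall i, f i = (free_lift f (theta i))^-1 * x_ i.
Proof.
pose step k (f : nat -> F_infty) j :=
  if j == k then (free_lift f (theta k))^-1 * x_ k else f j.
pose approx n := iteri n step (fun=> 1).
pose f j := approx j.+1 j.
have approxE n j : (j < n)%N -> approx n j = f j.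
  elim: n => // n IH; rewrite ltnS leq_eqVlt => /orP[/eqP -> //|jn].
  by rewrite -IH // /approx /= /step ltn_eqF.
exists f => i; rewrite {1}/f /approx /= {1}/step eqxx; congr (_^-1 * _).
apply: (eq_morphism_below (theta_below i)) => j ji.
by rewrite /= !free_lift_gen; apply: approxE.
Qed.

Variable phi : {multiplicative F_infty -> F_infty}.
Hypothesis phiE : forall i, phi (x_ i) = theta i * x_ i.

Lemma triangular_bijective : bijective phi.
Proof.
have [f fE] := triangular_recursion.
pose psi : {multiplicative F_infty -> F_infty} := free_lift f.
have psiE i : psi (x_ i) = (psi (theta i))^-1 * x_ i.
  by rewrite /psi /= free_lift_gen fE.
exists psi => w.
  apply: (@morphism_id (psi \o phi)) => i /=.
  by rewrite phiE gmulfM psiE mulVKg.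
(* On this side [phi (psi (theta i))] occurs, which is known only once
   [phi \o psi] fixes the generators of index below [i]. *)
apply: (@morphism_id (phi \o psi)) => {w} i /=.
have [n] := ubnP i; elim: n i => // n IH i /ltnSE le_in.
rewrite psiE gmulfM multiplicativeV phiE.
suff -> : phi (psi (theta i)) = theta i by rewrite mulKg.
apply: (@eq_morphism_below _ (phi \o psi) idfun i) => // j ji.
exact: IH (leq_trans ji le_in).
Qed.

(** With [theta i = x^-1], the element [x_ i] is a witness:
    [x_ i * (theta i * x_ i)^-1 = x]. *)
Lemma triangular_twisted_trivial :
  (forall g, exists i, theta i = g) -> forall x, reidemeister_equiv phi x 1.
Proof.
move=> theta_surj x; have [i thi] := theta_surj x^-1.
by exists (x_ i); rewrite phiE thi invgM invgK mulg1 mulVKg.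
Qed.

End Triangular.

(** The 2-adic valuation of the index serves as the code of a word, and takes
    each value at arbitrarily large indices. *)
Lemma triangular_surjection_exists : exists theta : nat -> F_infty,
  (forall g, exists i, theta i = g) /\
  (forall i, involves_only_below i (theta i)).
Proof.
pose decode k : F_infty :=
  let w := odflt [::] (choice.unpickle k : option (seq (nat * bool))) in
  odflt 1 (insub w : option (free_group nat)).
pose theta i :=
  let g := decode (logn 2 i) in if involves_only_below i g then g else 1.
exists theta; split=> [g|i]; last by rewrite /theta /=; case: ifP.
(* All letters of [g] have index below [N], and the odd factor [N.*2.+1] makes
   the index large without changing its 2-adic valuation. *)
pose N := \max_(a <- free_word g) a.1.+1.
pose k := choice.pickle (free_word g).
exists (2 ^ k * N.*2.+1)%N.
have -> : theta (2 ^ k * N.*2.+1)%N =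
    if involves_only_below (2 ^ k * N.*2.+1) g then g else 1.
  rewrite /theta lognM ?expn_gt0 // pfactorK // logn_coprime; last first.
    by rewrite coprime2n /= odd_double.
  by rewrite addn0 /decode choice.pickleK /= valK.
rewrite ifT //; apply/allP => a ag.
have aN : (a.1 < N)%N by apply: (leq_bigmax_seq (F := fun b => b.1.+1)).
apply: leq_trans aN _; apply: (@leq_trans N.*2.+1).
  by rewrite -addnn leqW // leq_addr.
by rewrite leq_pmull // expn_gt0.
Qed.

(** * Reidemeister number one *)

Theorem proposition5p1 :
  (forall theta : nat -> F_infty,
     (forall g : F_infty, exists i : nat, theta i = g) ->
     (forall i : nat, involves_only_below i (theta i)) ->
     forall phi : {multiplicative F_infty -> F_infty},
       (forall i : nat, phi (x_ i) = theta i * x_ i) ->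
       bijective phi /\ reidemeister_number phi = 1%N%:E%E) /\
  ~ R_infinity F_infty /\
  (forall c : nat, (0 < c)%N -> ~ R_infinity (N_infty c)) /\
  (forall c : nat, (0 < c)%N -> ~ R_infinity (M_infty c)) /\
  (forall k : nat, (0 < k)%N -> ~ R_infinity (S_infty k)).
Proof.
split=> [theta theta_surj theta_below phi phiE|].
  split; first exact: triangular_bijective phiE.
  exact/reidemeister_number_one/(triangular_twisted_trivial phiE).
have [theta [theta_surj theta_below]] := triangular_surjection_exists.
pose phi : {multiplicative F_infty -> F_infty} :=
  free_lift (fun i => theta i * x_ i).
have phiE i : phi (x_ i) = theta i * x_ i by apply: free_lift_gen.
have phi_bij := triangular_bijective theta_below phiE.
have triv := triangular_twisted_trivial phiE theta_surj.
split; first exact: trivial_not_R_infinity phi_bij triv.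
split=> [c _|]; last split=> [c _|k _].
- apply: quotient_not_R_infinity phi_bij triv.
  exact: lower_central_fully_invariant.
- apply: quotient_not_R_infinity phi_bij triv.
  apply: nproduct_fully_invariant; first exact: lower_central_fully_invariant.
  exact: derived_fully_invariant.
apply: quotient_not_R_infinity phi_bij triv.
exact: derived_fully_invariant.
Qed.
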